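(* Let $R\to S$ be a cyclically pure ring extension of Noetherian rings, where $R$ is a local ring with maximal ideal $\mathfrak m$, and let $\hat R$ be the $\mathfrak m$-adic completion of $R$. Then the ring homomorphism $\hat R\to S\otimes_R\hat R$ is also cyclically pure.
   Context: All rings are commutative with unity. A cyclically pure ring extension is an injective ring homomorphism $A\to B$ such that $A/I\to B/IB$ is injective for every ideal $I\subset A$. *)

(* Defs.v *)
From HB Require Import structures.
From mathcomp Require Import all_boot all_algebra.
From mathcomp Require Import boolp.

Set Implicit Arguments.
Unset Strict Implicit.
Unset Printing Implicit Defensive.

Import GRing.Theory.
Local Open Scope ring_scope.
Local Open Scope quotient_scope.

(* Rings are [comPzRingType]s, so the zero ring is allowed. *)

(* The library's [idealr] only covers proper ideals of nonzero rings; here the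
   unit ideal is included.  Membership is boolean, but since [asbool] turns any
   [Prop]-valued predicate into a boolean one, this is no restriction. *)
HB.mixin Record isIdeal (R : comPzRingType) (I : R -> bool) := {
  ideal_mulr_subproof : forall a, {in I, forall u, a * u \in I}
}.

#[short(type="ideal")]
HB.structure Definition Ideal (R : comPzRingType) :=
  {I of GRing.ZmodClosed R I & isIdeal R I}.

Lemma idealM (R : comPzRingType) (I : ideal R) a u : u \in I -> a * u \in I.
Proof. exact: ideal_mulr_subproof. Qed.

Section IdealGen.
Variables (R : comPzRingType) (X : R -> Prop).

Definition ideal_gen_pred : R -> bool := fun x =>
  `[< exists s : seq (R * R),
        (forall p, p \in s -> X p.2) /\ x = \sum_(p <- s) p.1 * p.2 >].

Lemma ideal_gen_zmod_closed : zmod_closed ideal_gen_pred.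
Proof.
split.
  by apply/asboolP; exists [::]; split=> //; rewrite big_nil.
move=> x y /asboolP[s [Xs ->]] /asboolP[t [Xt ->]]; apply/asboolP.
exists (s ++ [seq (- p.1, p.2) | p <- t]); split.
  move=> p; rewrite mem_cat => /orP[/Xs //|/mapP[q /Xt Xq ->]] //.
by rewrite big_cat /= big_map -sumrN; congr (_ + _); apply: eq_bigr => p _;
  rewrite mulNr.
Qed.

Lemma ideal_genM a : {in ideal_gen_pred, forall u, a * u \in ideal_gen_pred}.
Proof.
move=> x /asboolP[s [Xs ->]]; apply/asboolP.
exists [seq (a * p.1, p.2) | p <- s]; split.
  by move=> p /mapP[q /Xs Xq ->].
by rewrite big_map mulr_sumr; apply: eq_bigr => p _; rewrite mulrA.
Qed.

HB.instance Definition _ := GRing.isZmodClosed.Build R ideal_gen_pred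
  ideal_gen_zmod_closed.
HB.instance Definition _ := isIdeal.Build R ideal_gen_pred ideal_genM.

Definition ideal_gen : ideal R := Ideal.clone R ideal_gen_pred _.

Lemma mem_ideal_gen x : X x -> x \in ideal_gen.
Proof.
move=> Xx; apply/asboolP; exists [:: (1, x)].
by rewrite big_seq1 mul1r; split=> // p; rewrite inE => /eqP ->.
Qed.

Lemma ideal_gen_min (I : ideal R) :
  (forall x, X x -> x \in I) -> {subset ideal_gen <= I}.
Proof.
move=> XI _ /asboolP[s [Xs ->]]; rewrite big_seq.
by apply: rpred_sum => p /Xs/XI; apply: idealM.
Qed.

End IdealGen.

Section IdealOperations.
Variable R : comPzRingType.

Definition ideal_mul (I J : ideal R) : ideal R :=
  ideal_gen (fun x => exists u v, [/\ u \in I, v \in J & x = u * v]).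

Fixpoint ideal_pow (I : ideal R) (n : nat) : ideal R :=
  if n is n'.+1 then ideal_mul I (ideal_pow I n')
  else ideal_gen (fun x => x = 1).

Lemma ideal_powS I n : {subset ideal_pow I n.+1 <= ideal_pow I n}.
Proof. by apply: ideal_gen_min => _ [u [v [_ vJ ->]]]; apply: idealM. Qed.

Definition maximal_ideal (M : ideal R) : Prop :=
  1 \notin M /\
  forall J : ideal R, {subset M <= J} -> 1 \notin J -> {subset J <= M}.

Definition local_with (m : ideal R) : Prop :=
  maximal_ideal m /\ forall M : ideal R, maximal_ideal M -> M =i m.

End IdealOperations.

Definition noetherian (R : comPzRingType) : Prop :=
  forall I : ideal R, exists s : seq R, I =i ideal_gen (fun x => x \in s).

(* [I B], the extension of the ideal [I] along [f : A -> B]. *)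
Definition ideal_ext (A B : comPzRingType) (f : {rmorphism A -> B})
    (I : ideal A) : ideal B :=
  ideal_gen (fun y => exists2 x, x \in I & y = f x).

(* The additive group is the library's quotient; the library's ring structure
   on it is only available for [idealr]. *)
Section IdealQuotient.
Variables (R : comPzRingType) (I : ideal R).

Definition idquot := Quotient.quot I.
HB.instance Definition _ := GRing.Zmodule.on idquot.

Definition idproj (x : R) : idquot := \pi_(Quotient.quot I) x.
Definition idrepr (x : idquot) : R := repr (x : Quotient.quot I).

Lemma idreprK : cancel idrepr idproj.
Proof. exact: reprK. Qed.

Lemma idprojP x y : idproj x = idproj y <-> x - y \in I.
Proof.
by rewrite Quotient.idealrBE; split=> /eqP.
Qed.

Lemma idprojD x y : idproj (x + y) = idproj x + idproj y.
Proof. exact: Quotient.pi_add. Qed.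

Definition idquot_one : idquot := idproj 1.
Definition idquot_mul (x y : idquot) : idquot := idproj (idrepr x * idrepr y).

Lemma idprojM_subproof x y : idquot_mul (idproj x) (idproj y) = idproj (x * y).
Proof.
apply/idprojP; set x' := idrepr _; set y' := idrepr _.
have xI : x' - x \in I by apply/idprojP; rewrite idreprK.
have yI : y' - y \in I by apply/idprojP; rewrite idreprK.
have -> : x' * y' - x * y = y' * (x' - x) + x * (y' - y).
  by rewrite !mulrBr ![y' * _]mulrC addrA subrK.
by rewrite rpredD ?idealM.
Qed.

Fact idquot_mulA : associative idquot_mul.
Proof.
move=> x y z; rewrite -[x]idreprK -[y]idreprK -[z]idreprK.
by rewrite !idprojM_subproof mulrA.
Qed.
Fact idquot_mulC : commutative idquot_mul.
Proof. by move=> x y; rewrite /idquot_mul mulrC. Qed.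
Fact idquot_mul1 : left_id idquot_one idquot_mul.
Proof. by move=> x; rewrite -[x]idreprK idprojM_subproof mul1r. Qed.
Fact idquot_mulD : left_distributive idquot_mul +%R.
Proof.
move=> x y z; rewrite -[x]idreprK -[y]idreprK -[z]idreprK.
by rewrite -idprojD !idprojM_subproof -idprojD mulrDl.
Qed.

HB.instance Definition _ := GRing.Zmodule_isComPzRing.Build idquot
  idquot_mulA idquot_mulC idquot_mul1 idquot_mulD.

Fact idproj_zmod_morphism : zmod_morphism idproj.
Proof. by move=> x y; apply: (canRL (addrK _)); rewrite -idprojD subrK. Qed.
Fact idproj_monoid_morphism : monoid_morphism idproj.
Proof. by split=> // x y; rewrite -idprojM_subproof. Qed.
HB.instance Definition _ := GRing.isZmodMorphism.Build R idquot idproj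
  idproj_zmod_morphism.
HB.instance Definition _ := GRing.isMonoidMorphism.Build R idquot idproj
  idproj_monoid_morphism.

End IdealQuotient.

(* The map [A/I -> B/J] induced by [f]; independent of the choice of
   representatives when [f] maps [I] into [J],
   see [quot_mapE]. *)
Definition quot_map (A B : comPzRingType) (f : {rmorphism A -> B})
    (I : ideal A) (J : ideal B) (x : idquot I) : idquot J :=
  idproj J (f (idrepr x)).

Lemma quot_mapE (A B : comPzRingType) (f : {rmorphism A -> B})
    (I : ideal A) (J : ideal B) :
  (forall x, x \in I -> f x \in J) ->
  forall x, quot_map f J (idproj I x) = idproj J (f x).
Proof.
move=> fIJ x; apply/idprojP; rewrite -rmorphB; apply: fIJ.
by apply/idprojP; rewrite idreprK.
Qed.

Lemma quot_map_extE (A B : comPzRingType) (f : {rmorphism A -> B})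
    (I : ideal A) (x : A) :
  quot_map f (ideal_ext f I) (idproj I x) = idproj (ideal_ext f I) (f x).
Proof. by apply: quot_mapE => y Iy; apply: mem_ideal_gen; exists y. Qed.

Definition cyclically_pure (A B : comPzRingType) (f : {rmorphism A -> B}) :=
  injective f /\
  forall I : ideal A,
    injective (quot_map f (ideal_ext f I) : idquot I -> idquot (ideal_ext f I)).

(* The [m]-adic completion: the inverse limit of the rings [R/m^n]. *)
Section Completion.
Variables (R : comPzRingType) (m : ideal R).

Definition transition (n : nat) :
    idquot (ideal_pow m n.+1) -> idquot (ideal_pow m n) :=
  quot_map idfun (ideal_pow m n).

Lemma transitionE n x :
  transition (idproj (ideal_pow m n.+1) x) = idproj (ideal_pow m n) x.
Proof. by apply: quot_mapE => y; apply: ideal_powS. Qed.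

Fact transitionB n : {morph @transition n : x y / x - y}.
Proof.
move=> x y; rewrite -[x]idreprK -[y]idreprK -rmorphB.
by rewrite !transitionE rmorphB.
Qed.
Fact transitionM n : {morph @transition n : x y / x * y}.
Proof.
move=> x y; rewrite -[x]idreprK -[y]idreprK -rmorphM.
by rewrite !transitionE rmorphM.
Qed.
Fact transition1 n : transition (1 : idquot (ideal_pow m n.+1)) = 1.
Proof. by rewrite -[1 in LHS]/(idproj _ 1) transitionE. Qed.
Fact transition0 n : transition (0 : idquot (ideal_pow m n.+1)) = 0.
Proof. by rewrite -(subrr 0) transitionB subrr. Qed.
Fact transitionN n : {morph @transition n : x / - x}.
Proof. by move=> x; rewrite -sub0r transitionB transition0 sub0r. Qed.
Fact transitionD n : {morph @transition n : x y / x + y}.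
Proof. by move=> x y; rewrite -{1}[y]opprK transitionB transitionN opprK. Qed.

Record completion := Completion {
  comp_coord : forall n, idquot (ideal_pow m n);
  comp_coherent : forall n, transition (comp_coord n.+1) = comp_coord n
}.

Lemma completion_ext (x y : completion) :
  (forall n, comp_coord x n = comp_coord y n) -> x = y.
Proof.
case: x y => x xP [y yP] /= exy.
have {}exy := functional_extensionality_dep exy; subst y.
by rewrite (Prop_irrelevance xP yP).
Qed.

HB.instance Definition _ := gen_eqMixin completion.
HB.instance Definition _ := gen_choiceMixin completion.

Definition comp_zero := @Completion (fun n => 0) (fun n => transition0 n).
Definition comp_one := @Completion (fun n => 1) (fun n => transition1 n).

Fact comp_opp_subproof (x : completion) n :
  transition (- comp_coord x n.+1) = - comp_coord x n.
Proof. by rewrite transitionN comp_coherent. Qed.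
Definition comp_opp x := Completion (comp_opp_subproof x).

Fact comp_add_subproof (x y : completion) n :
  transition (comp_coord x n.+1 + comp_coord y n.+1) =
  comp_coord x n + comp_coord y n.
Proof. by rewrite transitionD !comp_coherent. Qed.
Definition comp_add x y := Completion (comp_add_subproof x y).

Fact comp_mul_subproof (x y : completion) n :
  transition (comp_coord x n.+1 * comp_coord y n.+1) =
  comp_coord x n * comp_coord y n.
Proof. by rewrite transitionM !comp_coherent. Qed.
Definition comp_mul x y := Completion (comp_mul_subproof x y).

Fact comp_addA : associative comp_add.
Proof. by move=> x y z; apply: completion_ext => n /=; rewrite addrA. Qed.
Fact comp_addC : commutative comp_add.
Proof. by move=> x y; apply: completion_ext => n /=; rewrite addrC. Qed.
Fact comp_add0 : left_id comp_zero comp_add.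
Proof. by move=> x; apply: completion_ext => n /=; rewrite add0r. Qed.
Fact comp_addN : left_inverse comp_zero comp_opp comp_add.
Proof. by move=> x; apply: completion_ext => n /=; rewrite addNr. Qed.
HB.instance Definition _ := GRing.isZmodule.Build completion
  comp_addA comp_addC comp_add0 comp_addN.

Fact comp_mulA : associative comp_mul.
Proof. by move=> x y z; apply: completion_ext => n /=; rewrite mulrA. Qed.
Fact comp_mulC : commutative comp_mul.
Proof. by move=> x y; apply: completion_ext => n /=; rewrite mulrC. Qed.
Fact comp_mul1 : left_id comp_one comp_mul.
Proof. by move=> x; apply: completion_ext => n /=; rewrite mul1r. Qed.
Fact comp_mulD : left_distributive comp_mul +%R.
Proof. by move=> x y z; apply: completion_ext => n /=; rewrite mulrDl. Qed.
HB.instance Definition _ := GRing.Zmodule_isComPzRing.Build completion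
  comp_mulA comp_mulC comp_mul1 comp_mulD.

Definition to_completion (x : R) : completion :=
  @Completion (fun n => idproj (ideal_pow m n) x) (fun n => transitionE n x).

Fact to_completion_zmod_morphism : zmod_morphism to_completion.
Proof. by move=> x y; apply: completion_ext => n /=; rewrite rmorphB. Qed.
Fact to_completion_monoid_morphism : monoid_morphism to_completion.
Proof.
by split=> [|x y]; apply: completion_ext => n /=; rewrite ?rmorph1 ?rmorphM.
Qed.
HB.instance Definition _ := GRing.isZmodMorphism.Build R completion
  to_completion to_completion_zmod_morphism.
HB.instance Definition _ := GRing.isMonoidMorphism.Build R completion
  to_completion to_completion_monoid_morphism.

End Completion.

(* The tensor product of the [R]-algebras [f : R -> A] and [g : R -> B].  A
   sequence [:: (a1, b1); ...; (ak, bk)] stands for the formal sum of the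
   [ai (x) bi], and [tens_rel] is the congruence generated by commutativity,
   biadditivity and [R]-balancedness. *)
Section Tensor.
Variables (R A B : comPzRingType).
Variables (f : {rmorphism R -> A}) (g : {rmorphism R -> B}).

Inductive tens_rel : seq (A * B) -> seq (A * B) -> Prop :=
| tens_refl u : tens_rel u u
| tens_sym u v : tens_rel u v -> tens_rel v u
| tens_trans u v w : tens_rel u v -> tens_rel v w -> tens_rel u w
| tens_cat u u' v v' :
    tens_rel u u' -> tens_rel v v' -> tens_rel (u ++ v) (u' ++ v')
| tens_catC u v : tens_rel (u ++ v) (v ++ u)
| tens_zero b : tens_rel [:: (0, b)] [::]
| tens_addl a a' b : tens_rel [:: (a + a', b)] [:: (a, b); (a', b)]
| tens_addr a b b' : tens_rel [:: (a, b + b')] [:: (a, b); (a, b')]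
| tens_balanced a r b : tens_rel [:: (a * f r, b)] [:: (a, g r * b)].

Definition tens_relb (u v : seq (A * B)) := `[< tens_rel u v >].

Fact tens_relb_refl : reflexive tens_relb.
Proof. by move=> u; apply/asboolP; apply: tens_refl. Qed.
Fact tens_relb_sym : symmetric tens_relb.
Proof. by move=> u v; apply/asboolP/asboolP; apply: tens_sym. Qed.
Fact tens_relb_trans : transitive tens_relb.
Proof.
by move=> v u w /asboolP uv /asboolP vw; apply/asboolP; apply: tens_trans vw.
Qed.
Canonical tens_equiv :=
  EquivRel tens_relb tens_relb_refl tens_relb_sym tens_relb_trans.
Canonical tens_encModRel := defaultEncModRel tens_relb.

Definition tensor := {eq_quot tens_relb}.
HB.instance Definition _ := Choice.on tensor.

Definition tens_class (u : seq (A * B)) : tensor := \pi_({eq_quot tens_relb}) u.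
Definition tens_repr (x : tensor) : seq (A * B) :=
  repr (x : {eq_quot tens_relb}).

Lemma tens_reprK : cancel tens_repr tens_class.
Proof. exact: reprK. Qed.

Lemma tens_classP u v : tens_class u = tens_class v <-> tens_rel u v.
Proof.
by split=> [/eqmodP/asboolP //|uv]; apply/eqmodP/asboolP.
Qed.

Lemma tens_repr_rel u : tens_rel (tens_repr (tens_class u)) u.
Proof. by apply/tens_classP; rewrite tens_reprK. Qed.

Definition sum_opp (u : seq (A * B)) := [seq (- p.1, p.2) | p <- u].
Definition sum_mul (u v : seq (A * B)) :=
  [seq (p.1 * q.1, p.2 * q.2) | p <- u, q <- v].

Lemma tens_perm u v : perm_eq u v -> tens_rel u v.
Proof.
elim: u v => [|p u IHu] v.
  by rewrite perm_sym => /perm_nilP ->; apply: tens_refl.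
move=> /[dup] /perm_mem /(_ p); rewrite mem_head => /esym.
case/splitPr=> v1 v2; rewrite perm_sym perm_catC /= perm_cons perm_sym => puv.
have puv' : perm_eq u (v1 ++ v2) by rewrite (permPl puv) perm_catC.
apply: (@tens_trans _ ((p :: v2) ++ v1)); last exact: tens_catC.
by apply: (tens_cat (tens_refl [:: p])); apply: IHu.
Qed.

Lemma sum_mul_cat u u' v : sum_mul (u ++ u') v = sum_mul u v ++ sum_mul u' v.
Proof. exact: allpairs_cat. Qed.

Fact tens_rel_double p p1 p2 v w1 w2 :
  tens_rel [:: p] [:: p1; p2] -> tens_rel v (w1 ++ w2) ->
  tens_rel (p :: v) ((p1 :: w1) ++ (p2 :: w2)).
Proof.
move=> pp vw; apply: tens_trans (tens_cat pp vw) _.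
by apply: tens_perm; rewrite /= perm_cons perm_sym -cat1s perm_catCA.
Qed.

Fact sum_mul_congl u u' v :
  tens_rel u u' -> tens_rel (sum_mul u v) (sum_mul u' v).
Proof.
elim=> {u u'} [u|u u' _|u1 u2 u3 _ IH1 _ IH2|u u' w w' _ IHu _ IHw|u w|b
              |a a' b|a b b'|a r b].
- exact: tens_refl.
- exact: tens_sym.
- exact: tens_trans IH2.
- by rewrite !sum_mul_cat; apply: tens_cat.
- by rewrite !sum_mul_cat; apply: tens_catC.
- rewrite /sum_mul /= cats0; elim: v => [|q v IHv] /=; first exact: tens_refl.
  by rewrite mul0r; apply: (tens_cat (tens_zero _) IHv).
- rewrite /sum_mul /= !cats0; elim: v => [|q v IHv]; first exact: tens_refl.
  by apply: tens_rel_double IHv => /=; rewrite mulrDl; apply: tens_addl.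
- rewrite /sum_mul /= !cats0; elim: v => [|q v IHv]; first exact: tens_refl.
  by apply: tens_rel_double IHv => /=; rewrite mulrDl; apply: tens_addr.
- rewrite /sum_mul /= !cats0; elim: v => [|q v IHv]; first exact: tens_refl.
  apply: (@tens_cat [:: _] [:: _] _ _ _ IHv) => /=.
  by rewrite mulrAC -[g r * b * _]mulrA; apply: tens_balanced.
Qed.

Fact sum_mulC u v : tens_rel (sum_mul u v) (sum_mul v u).
Proof.
elim: u => [|p u IHu].
  by rewrite /sum_mul allpairs0r; apply: tens_refl.
rewrite /sum_mul allpairs_cons.
apply: (@tens_trans _ (sum_mul v [:: p] ++ sum_mul v u)).
  apply: tens_cat IHu; rewrite /sum_mul allpairs1r.
  by under eq_map do rewrite mulrC [p.2 * _]mulrC; apply: tens_refl.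
apply: tens_sym; apply: tens_perm.
by rewrite -[p :: u]cat1s perm_allpairs_catr.
Qed.

Definition tens_0 : tensor := tens_class [::].
Definition tens_1 : tensor := tens_class [:: (1, 1)].
Definition tens_opp (x : tensor) : tensor := tens_class (sum_opp (tens_repr x)).
Definition tens_add (x y : tensor) : tensor :=
  tens_class (tens_repr x ++ tens_repr y).
Definition tens_mul (x y : tensor) : tensor :=
  tens_class (sum_mul (tens_repr x) (tens_repr y)).

Lemma tens_addE u v :
  tens_add (tens_class u) (tens_class v) = tens_class (u ++ v).
Proof. by apply/tens_classP/tens_cat; apply: tens_repr_rel. Qed.

Lemma tens_mulE u v :
  tens_mul (tens_class u) (tens_class v) = tens_class (sum_mul u v).
Proof.
apply/tens_classP; apply: tens_trans (sum_mul_congl _ (tens_repr_rel _)) _.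
apply: tens_trans (sum_mulC _ _) _; apply: tens_trans (sum_mulC _ _).
exact: sum_mul_congl (tens_repr_rel _).
Qed.

Fact sum_addN u : tens_rel (sum_opp u ++ u) [::].
Proof.
elim: u => [|[a b] u IHu] /=; first exact: tens_refl.
apply: (@tens_trans _ ([:: (- a, b); (a, b)] ++ (sum_opp u ++ u))).
  by apply: tens_perm; rewrite /= perm_cons perm_catC /= perm_cons perm_catC.
apply: (@tens_cat _ [::] _ [::] _ IHu).
apply: tens_trans (tens_sym (tens_addl _ _ _)) _.
by rewrite addNr; apply: tens_zero.
Qed.

Fact tens_addA : associative tens_add.
Proof.
move=> x y z; rewrite -[x]tens_reprK -[y]tens_reprK -[z]tens_reprK.
by rewrite !tens_addE catA.
Qed.
Fact tens_addC : commutative tens_add.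
Proof. by move=> x y; apply/tens_classP; apply: tens_catC. Qed.
Fact tens_add0 : left_id tens_0 tens_add.
Proof. by move=> x; rewrite -[x]tens_reprK [LHS]tens_addE. Qed.
Fact tens_addN : left_inverse tens_0 tens_opp tens_add.
Proof.
move=> x; rewrite -{2}[x]tens_reprK [LHS]tens_addE.
by apply/tens_classP; apply: sum_addN.
Qed.
HB.instance Definition _ := GRing.isZmodule.Build tensor
  tens_addA tens_addC tens_add0 tens_addN.

Fact tens_mulA : associative tens_mul.
Proof.
move=> x y z; rewrite -[x]tens_reprK -[y]tens_reprK -[z]tens_reprK.
move: (tens_repr x) (tens_repr y) (tens_repr z) => u v w.
rewrite !tens_mulE; congr tens_class; elim: u => //= p u IHu.
rewrite -[p :: u]cat1s !sum_mul_cat -IHu; congr (_ ++ _).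
rewrite /sum_mul /= !cats0; elim: v {IHu} => //= q v IHv.
rewrite map_cat IHv; congr (_ ++ _).
by rewrite -map_comp; apply: eq_map => r /=; rewrite !mulrA.
Qed.
Fact tens_mulC : commutative tens_mul.
Proof. by move=> x y; apply/tens_classP; apply: sum_mulC. Qed.
Fact tens_mul1 : left_id tens_1 tens_mul.
Proof.
move=> x; rewrite -[x]tens_reprK tens_mulE /sum_mul /= cats0.
by under eq_map do rewrite !mul1r -surjective_pairing; rewrite map_id.
Qed.
Fact tens_mulD : left_distributive tens_mul +%R.
Proof.
move=> x y z; rewrite -[x]tens_reprK -[y]tens_reprK -[z]tens_reprK.
by rewrite [_ + _ in LHS]tens_addE !tens_mulE sum_mul_cat [RHS]tens_addE.
Qed.
HB.instance Definition _ := GRing.Zmodule_isComPzRing.Build tensor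
  tens_mulA tens_mulC tens_mul1 tens_mulD.

Definition tens (a : A) (b : B) : tensor := tens_class [:: (a, b)].
Definition tens_inl (a : A) : tensor := tens a 1.
Definition tens_inr (b : B) : tensor := tens 1 b.

Lemma tensDl a a' b : tens (a + a') b = tens a b + tens a' b.
Proof. rewrite [RHS]tens_addE; apply/tens_classP; exact: tens_addl. Qed.
Lemma tensDr a b b' : tens a (b + b') = tens a b + tens a b'.
Proof. rewrite [RHS]tens_addE; apply/tens_classP; exact: tens_addr. Qed.
Lemma tensM a b a' b' : tens a b * tens a' b' = tens (a * a') (b * b').
Proof. exact: tens_mulE. Qed.
Lemma tens_bal a r b : tens (a * f r) b = tens a (g r * b).
Proof. by apply/tens_classP; apply: tens_balanced. Qed.

Lemma tens_sum u : tens_class u = \sum_(p <- u) tens p.1 p.2.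
Proof.
elim: u => [|[a b] u IHu]; first by rewrite big_nil.
by rewrite big_cons -IHu [RHS]tens_addE.
Qed.

Fact tens_inl_zmod_morphism : zmod_morphism tens_inl.
Proof. by move=> x y; apply: (canRL (addrK _)); rewrite -tensDl subrK. Qed.
Fact tens_inl_monoid_morphism : monoid_morphism tens_inl.
Proof. by split=> // x y; rewrite tensM mulr1. Qed.
HB.instance Definition _ := GRing.isZmodMorphism.Build A tensor tens_inl
  tens_inl_zmod_morphism.
HB.instance Definition _ := GRing.isMonoidMorphism.Build A tensor tens_inl
  tens_inl_monoid_morphism.

Fact tens_inr_zmod_morphism : zmod_morphism tens_inr.
Proof. by move=> x y; apply: (canRL (addrK _)); rewrite -tensDr subrK. Qed.
Fact tens_inr_monoid_morphism : monoid_morphism tens_inr.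
Proof. by split=> // x y; rewrite tensM mulr1. Qed.
HB.instance Definition _ := GRing.isZmodMorphism.Build B tensor tens_inr
  tens_inr_zmod_morphism.
HB.instance Definition _ := GRing.isMonoidMorphism.Build B tensor tens_inr
  tens_inr_monoid_morphism.

Lemma tens_inlr r : tens_inl (f r) = tens_inr (g r).
Proof. by rewrite /tens_inl -[f r]mul1r tens_bal mulr1. Qed.

Lemma tensor_rec (V : zmodType) (phi : A -> B -> V) :
  (forall a a' b, phi (a + a') b = phi a b + phi a' b) ->
  (forall a b b', phi a (b + b') = phi a b + phi a b') ->
  (forall a r b, phi (a * f r) b = phi a (g r * b)) ->
  exists h : {additive tensor -> V}, forall a b, h (tens a b) = phi a b.
Proof.
move=> phiDl phiDr phi_bal.
pose ev u := \sum_(p <- u) phi p.1 p.2.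
have ev_rel u v : tens_rel u v -> ev u = ev v.
  elim=> {u v} //.
  - by move=> u v w _ -> _ ->.
  - by move=> u u' v v' _ + _; rewrite /ev !big_cat => -> ->.
  - by move=> u v; rewrite /ev !big_cat /= addrC.
  - move=> b; rewrite /ev big_seq1 big_nil /=.
    by apply: (@addrI _ (phi 0 b)); rewrite -phiDl !addr0.
  - by move=> a a' b; rewrite /ev !big_cons !big_nil !addr0 phiDl.
  - by move=> a b b'; rewrite /ev !big_cons !big_nil !addr0 phiDr.
  - by move=> a r b; rewrite /ev !big_seq1 phi_bal.
pose h (x : tensor) := ev (tens_repr x).
have hE u : h (tens_class u) = ev u by apply/ev_rel/tens_repr_rel.
have hD x y : h (x + y) = h x + h y.
  rewrite -[x]tens_reprK -[y]tens_reprK [_ + _]tens_addE !hE.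
  by rewrite /ev big_cat.
have hB : zmod_morphism h.
  by move=> x y; apply: (canRL (addrK _)); rewrite -hD subrK.
pose H := GRing.isZmodMorphism.Build tensor V h hB.
pose hh : {additive tensor -> V} := HB.pack h H.
by exists hh => a b; rewrite /= hE /ev big_seq1.
Qed.

End Tensor.

(* Main.v *)
(* If [1 (x) x] lies in [I (S (x) R^)], then it already lies in [I' (S (x) R^)]
   for a finitely generated ideal [I'] contained in [I].  Let [K_n] be the
   kernel of [R^ -> R/m^n] and [I0] the preimage of [I' + K_n] in [R].  Since
   [m^n] is contained in [I0], there is a map [S (x) R^ -> S / I0 S], and purity
   of [R -> S] at [I0] yields that [x] is in [I' + K_n].  It remains to see that
   finitely generated ideals of [R^] are closed.  As each [R/m^n] is Artinian,
   a decreasing sequence of cosets of ideals [L_n] containing [K_n] has a common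
   point; applied to [L_n = (J + K_n : a)], this shows that [J + (a)] is closed
   whenever [J] is. *)
Require Import Defs.
From mathcomp Require Import all_boot all_algebra.
From mathcomp Require Import boolp ring.

Set Implicit Arguments.
Unset Strict Implicit.
Unset Printing Implicit Defensive.

Import GRing.Theory.
Local Open Scope ring_scope.

(** * Stabilisation of decreasing chains modulo powers of [m] *)

Section Ideals.
Variable R : comPzRingType.
Implicit Types (I J B : ideal R) (a x : R) (s : seq R).

(** Lets [ideal_gen] bundle a predicate that is already an ideal, without enlarging it. *)
Lemma mem_ideal_genE (P : R -> Prop) :
  P 0 -> (forall x y, P x -> P y -> P (x - y)) ->
  (forall a x, P x -> P (a * x)) ->
  forall x, x \in ideal_gen P <-> P x.
Proof.
move=> P0 PB PM x; split; last exact: mem_ideal_gen.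
have PD y z : P y -> P z -> P (y + z).
  by move=> Py Pz; rewrite -[z]opprK -[- z]sub0r; exact: PB (PB _ _ P0 Pz).
case/asboolP=> s [Ps ->]; elim: s Ps => [|p s IHs] Ps; first by rewrite big_nil.
rewrite big_cons; apply: PD; first by apply/PM/Ps; rewrite mem_head.
by apply: IHs => q qs; apply: Ps; rewrite inE qs orbT.
Qed.

Lemma idproj_eq0 I x : idproj I x = 0 <-> x \in I.
Proof. by rewrite -[X in X \in I]subr0 -(rmorph0 (idproj I)); apply: idprojP. Qed.

(** This is [B + (a)]. *)
Definition adjoin B a : ideal R := ideal_gen (fun x => exists r, x - r * a \in B).

Lemma mem_adjoin B a x : x \in adjoin B a <-> exists r, x - r * a \in B.
Proof.
apply: mem_ideal_genE => [|y z [r yB] [t zB]|b y [r yB]].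
- by exists 0; rewrite mul0r subr0 rpred0.
- exists (r - t).
  have -> : y - z - (r - t) * a = (y - r * a) - (z - t * a) by ring.
  exact: rpredB.
- by exists (b * r); rewrite -mulrA -mulrBr idealM.
Qed.

Lemma sub_adjoin B a : {subset B <= adjoin B a}.
Proof. by move=> x xB; apply/mem_adjoin; exists 0; rewrite mul0r subr0. Qed.

Lemma adjoin_mem B a : a \in adjoin B a.
Proof. by apply/mem_adjoin; exists 1; rewrite mul1r subrr rpred0. Qed.

Definition adjoin_seq B s : ideal R := foldr (fun a J => adjoin J a) B s.

Lemma sub_adjoin_seq B s : {subset B <= adjoin_seq B s}.
Proof. by elim: s => [//|a s IHs] x /IHs; apply: sub_adjoin. Qed.

Lemma adjoin_seq_mem B s : {subset s <= adjoin_seq B s}.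
Proof.
elim: s => [//|a s IHs] x; rewrite inE => /predU1P[->|/IHs].
  exact: adjoin_mem.
exact: sub_adjoin.
Qed.

Lemma adjoin_seq_min B s I :
  {subset B <= I} -> {subset s <= I} -> {subset adjoin_seq B s <= I}.
Proof.
move=> BI; elim: s => [//|a s IHs] sI x /mem_adjoin[r xra].
rewrite -[x](subrK (r * a)) rpredD //; last by rewrite idealM ?sI ?mem_head.
by apply: IHs xra => y ys; apply: sI; rewrite inE ys orbT.
Qed.

(* [stab M B]: the images of the decreasing chain [M] modulo [B] stabilise. *)
Definition stab (M : nat -> ideal R) B := exists q, forall p, (q <= p)%N ->
  forall x, x \in M q -> exists2 y, y \in M p & x - y \in B.

(** The quotient [(B + (a)) / B] is killed by [m], so it is zero or simple: either some [M p] meets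
    [B + (a)] inside [B], or every [M p] contains [a] modulo [B]. *)
Lemma stab_adjoin (m : ideal R) (M : nat -> ideal R) B a :
  maximal_ideal m -> (forall p q, (p <= q)%N -> {subset M q <= M p}) ->
  (forall r, r \in m -> r * a \in B) -> stab M (adjoin B a) -> stab M B.
Proof.
move=> [m1 mmax] Mle maB [q Mq].
have [[p0 Mp0]|/forallNP Mbig] :=
    pselect (exists p, forall x, x \in M p -> x \in adjoin B a -> x \in B).
  exists (maxn q p0) => p; rewrite geq_max => /andP[qp p0p] x xM.
  have [|y yM xyA] := Mq p qp x; first exact: Mle (leq_maxl _ _) _ xM.
  exists y => //; apply: Mp0 xyA; rewrite rpredB //.
    exact: Mle (leq_maxr _ _) _ xM.
  exact: Mle p0p _ yM.
exists q => p qp x xM; have [y yM /mem_adjoin[t xyB]] := Mq p qp x xM.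
(* Adding [t * z] to [y] absorbs the remainder [t * a] modulo [B]. *)
suff [z zM azB] : exists2 z, z \in M p & a - z \in B.
  exists (y + t * z); first by rewrite rpredD ?idealM.
  rewrite (_ : _ - _ = (x - y - t * a) + t * (a - z)); last by ring.
  by rewrite rpredD ?idealM.
have /existsNP[z /not_implyP[zM /not_implyP[/mem_adjoin[r zrB] zB]]] := Mbig p.
have [rm|rm] := boolP (r \in m).
  by case: zB; rewrite -[z](subrK (r * a)) rpredD ?maB.
(* [r] is invertible modulo [m]. *)
have : 1 \in adjoin m r.
  apply: contraT => /(mmax _ (@sub_adjoin m r)) /(_ _ (adjoin_mem m r)).
  by rewrite (negPf rm).
case/mem_adjoin=> b /maB brB; exists (b * z); first exact: idealM.
rewrite (_ : a - _ = (1 - b * r) * a - b * (z - r * a)); last by ring.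
exact: rpredB brB (idealM _ zrB).
Qed.

(** Each layer [m^n / m^(n+1)] is spanned over [R / m] by finitely many generators, which are
    removed one at a time. *)
Lemma stab_ideal_pow (m : ideal R) (M : nat -> ideal R) n :
  noetherian R -> maximal_ideal m ->
  (forall p q, (p <= q)%N -> {subset M q <= M p}) -> stab M (ideal_pow m n).
Proof.
move=> noeR mmax Mle; elim: n => [|n [q Mq]].
  exists 0 => p _ x _; exists 0; rewrite ?rpred0 // -[x - 0]mulr1 idealM //.
  exact: mem_ideal_gen.
have [s sE] := noeR (ideal_pow m n).
have ms r a : r \in m -> a \in s -> r * a \in ideal_pow m n.+1.
  move=> rm /= as_; apply: mem_ideal_gen; exists r, a; split=> //.
  by rewrite sE mem_ideal_gen.
(* Adjoining [s] to [m^(n+1)] recovers all of [m^n], where the chain is stable by induction. *)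
have : stab M (adjoin_seq (ideal_pow m n.+1) s).
  exists q => p qp x /(Mq p qp)[y yM]; rewrite sE => xy; exists y => //.
  exact: ideal_gen_min (@adjoin_seq_mem _ _) _ xy.
elim: s ms {sE} => [//|a s IHs] ms; move/(stab_adjoin mmax Mle) => st.
apply: IHs => [r b rm bs|]; first by rewrite ms // inE bs orbT.
by apply: st => r rm; apply/sub_adjoin_seq/ms; rewrite ?mem_head.
Qed.

End Ideals.

(** * Closed ideals of the completion *)

Section Completion.
Variables (R : comPzRingType) (m : ideal R).
Local Notation Rh := (completion m).
Implicit Types (x y z : Rh) (J : ideal Rh).

Definition congr_comp n x y := comp_coord x n = comp_coord y n.

Lemma congr_compS n x y : congr_comp n.+1 x y -> congr_comp n x y.
Proof. by move=> xy; rewrite /congr_comp -(comp_coherent x) -(comp_coherent y) xy. Qed.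

Lemma congr_compB n x x' y y' :
  congr_comp n x x' -> congr_comp n y y' -> congr_comp n (x - y) (x' - y').
Proof. by rewrite /congr_comp /= => -> ->. Qed.

Lemma congr_compM n a x y : congr_comp n x y -> congr_comp n (a * x) (a * y).
Proof. by rewrite /congr_comp /= => ->. Qed.

Lemma congr_comp_repr n x :
  congr_comp n (to_completion m (idrepr (comp_coord x n))) x.
Proof. by rewrite /congr_comp /= idreprK. Qed.

Lemma congr_to_completion n r t : r - t \in ideal_pow m n ->
  congr_comp n (to_completion m r) (to_completion m t).
Proof. by move=> rt; apply/idprojP. Qed.

(* [near n J x] is membership in [J + K_n], where [K_n] is the kernel of the
   projection to [R/m^n]. *)
Definition near n J x := exists2 y, y \in J & congr_comp n x y.

Lemma near0 n J : near n J 0.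
Proof. by exists 0; rewrite ?rpred0. Qed.

Lemma nearB n J x y : near n J x -> near n J y -> near n J (x - y).
Proof.
move=> [x' x'J xx'] [y' y'J yy']; exists (x' - y'); first exact: rpredB.
exact: congr_compB.
Qed.

Lemma nearM n J a x : near n J x -> near n J (a * x).
Proof.
by move=> [y yJ xy]; exists (a * y); [apply: idealM | apply: congr_compM].
Qed.

Lemma near_congr n J x y : congr_comp n x y -> near n J y -> near n J x.
Proof. by move=> xy [z zJ yz]; exists z => //; apply: etrans yz. Qed.

Lemma nearS n J x : near n.+1 J x -> near n J x.
Proof. by move=> [y yJ xy]; exists y => //; apply: congr_compS. Qed.

(** The ideal quotient [(J + K_n : a)]. *)
Definition colon n J a : ideal Rh := ideal_gen (fun c => near n J (c * a)).

Lemma mem_colon n J a c : c \in colon n J a <-> near n J (c * a).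
Proof.
apply: (mem_ideal_genE (P := fun c => near n J (c * a))) => [|b d bn dn|b d].
- by rewrite mul0r; apply: near0.
- by rewrite mulrBl; apply: nearB.
- by rewrite -mulrA; apply: nearM.
Qed.

Definition contract n J : ideal R :=
  ideal_gen (fun r => near n J (to_completion m r)).

Lemma mem_contract n J r : r \in contract n J <-> near n J (to_completion m r).
Proof.
apply: (mem_ideal_genE (P := fun r => near n J (to_completion m r))).
- by rewrite rmorph0; apply: near0.
- by move=> t u tn un; rewrite rmorphB; apply: nearB.
- by move=> t u; rewrite rmorphM; apply: nearM.
Qed.

Lemma ideal_pow_contract n J : {subset ideal_pow m n <= contract n J}.
Proof.
move=> r rm; apply/mem_contract; apply: near_congr (near0 n J).
by rewrite -(rmorph0 (to_completion m)); apply: congr_to_completion; rewrite subr0.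
Qed.

(** The intersection of the [J + K_n] is the closure of [J] when the [K_n] are the basic
    neighbourhoods of 0. *)
Definition closed J := forall x, (forall n, near n J x) -> x \in J.

Lemma complete (d : nat -> Rh) :
  (forall n, congr_comp n (d n.+1) (d n)) ->
  exists x, forall n, congr_comp n x (d n).
Proof.
move=> dP; suff coh n : transition (comp_coord (d n.+1) n.+1) = comp_coord (d n) n.
  by exists (Completion coh).
by rewrite comp_coherent dP.
Qed.

Hypotheses (noeR : noetherian R) (mmax : maximal_ideal m).

(** Every element of the completion agrees modulo [K_n] with one coming from [R], so stability of
    the contracted chain modulo [m^n] carries over to [L]. *)
Lemma stab_near (L : nat -> ideal Rh) n :
  (forall p q, (p <= q)%N -> {subset L q <= L p}) ->
  exists q, forall p, (q <= p)%N -> forall x, x \in L q -> near n (L p) x.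
Proof.
move=> Lle; have [p q pq r|q Mq] :=
    @stab_ideal_pow _ m (fun p => contract n (L p)) n noeR mmax.
  move/mem_contract => [y yL ry]; apply/mem_contract; exists y => //.
  exact: Lle pq _ yL.
exists q => p qp x xL; set r := idrepr (comp_coord x n).
have [|t /mem_contract tL rtm] := Mq p qp r.
  by apply/mem_contract; exists x => //; apply: congr_comp_repr.
apply: near_congr tL; rewrite /congr_comp -congr_comp_repr.
exact: congr_to_completion.
Qed.

(** A Mittag-Leffler argument: the cosets [c n + L n] decrease, and a Cauchy sequence [d] is chosen
    with [d n] in the coset of index [Q n]. Its limit lies in all of them because [L n] contains
    [K_n]. *)
Lemma linearly_compact (L : nat -> ideal Rh) (c : nat -> Rh) :
  (forall n, {subset L n.+1 <= L n}) ->
  (forall n x, congr_comp n x 0 -> x \in L n) ->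
  (forall n, c n.+1 - c n \in L n) ->
  exists d, forall n, d - c n \in L n.
Proof.
move=> LS KL cS.
have Lle p q : (p <= q)%N -> {subset L q <= L p}.
  move=> /subnKC <-; elim: (q - p)%N => [|k IHk] x; first by rewrite addn0.
  by rewrite addnS => /LS/IHk.
have cle p q : (p <= q)%N -> c q - c p \in L p.
  move=> /subnKC <-; elim: (q - p)%N => [|k IHk]; first by rewrite addn0 subrr rpred0.
  rewrite addnS -[c _](subrK (c (p + k)%N)) -addrA rpredD //.
  exact: Lle (leq_addr k p) _ (cS _).
have [q qP] := choice (fun n => @stab_near L n Lle).
(* Summing makes [Q] nondecreasing, with [Q n] at least [q n] and at least [n]. *)
pose Q n := (\sum_(i < n.+1) (q i + i))%N.
have QS n : (Q n <= Q n.+1)%N by rewrite /Q [leqRHS]big_ord_recr leq_addr.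
have qQ n : (q n + n <= Q n)%N by rewrite /Q big_ord_recr leq_addl.
(* The membership premise sits under [exists] so that [choice] yields a total function; the value
   [0] off the coset is arbitrary. *)
have stepP n x : exists y, x - c (Q n) \in L (Q n) ->
    y - c (Q n.+1) \in L (Q n.+1) /\ congr_comp n y x.
  have [xL|] := boolP (x - c (Q n) \in L (Q n)); last by exists 0.
  have xL' : x - c (Q n.+1) \in L (q n).
    apply: (Lle _ (Q n)); first exact: leq_trans (leq_addr _ _) (qQ n).
    rewrite -[x](subrK (c (Q n))) -addrA rpredD // -opprB rpredN.
    exact: cle (QS n).
  have [|y yL xy] := qP n (Q n.+1) _ _ xL'.
    exact: leq_trans (leq_trans (leq_addr _ _) (qQ n)) (QS n).
  exists (y + c (Q n.+1)) => _; split; first by rewrite addrK.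
  by move: xy; rewrite /congr_comp /= => <-; rewrite subrK.
have [g gP] := choice (fun nx : nat * Rh => stepP nx.1 nx.2).
pose d := nat_rect (fun _ => Rh) (c (Q 0)) (fun n x => g (n, x)).
have dL n : d n - c (Q n) \in L (Q n).
  elim: n => [|n IHn]; first by rewrite subrr rpred0.
  by case: (gP (n, d n) IHn).
have [x xd] : exists x, forall n, congr_comp n x (d n).
  by apply: complete => n; case: (gP (n, d n) (dL n)).
exists x => n; have nQ : (n <= Q n)%N := leq_trans (leq_addl _ _) (qQ n).
rewrite -[x](subrK (d n)) -addrA rpredD //.
  by apply: KL; rewrite -(subrr (d n)); apply: congr_compB.
rewrite -[d n](subrK (c (Q n))) -addrA rpredD ?cle //.
exact: Lle nQ _ (dL n).
Qed.

(** The coefficients [c] with [x - c * a] in [J + K_n] form a coset of [colon n J a]. A common point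
    [d] of these cosets puts [x - d * a] in every [J + K_n], hence in [J]. *)
Lemma closed_adjoin J a : closed J -> closed (adjoin J a).
Proof.
move=> clJ x xnear.
have {xnear} /choice[c cP] n : exists c : Rh, near n J (x - c * a).
  have [y /mem_adjoin[c ycJ] xy] := xnear n.
  by exists c; exists (y - c * a) => //; apply: congr_compB.
have [||n|d dP] := @linearly_compact (fun n => colon n J a) c.
- by move=> n b /mem_colon/nearS bn; apply/mem_colon.
- move=> n b b0; apply/mem_colon; rewrite mulrC; apply: near_congr (near0 n J).
  by rewrite -[0](mulr0 a); apply: congr_compM.
- apply/mem_colon.
  have -> : (c n.+1 - c n) * a = (x - c n * a) - (x - c n.+1 * a).
    by ring.
  by apply: nearB (cP n) (nearS (cP n.+1)).
apply/mem_adjoin; exists d; apply: clJ => n.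
have -> : x - d * a = (x - c n * a) - (d - c n) * a.
  by ring.
by apply: nearB (cP n) _; apply/mem_colon.
Qed.

Definition zero_ideal : ideal Rh := ideal_gen (fun x => x = 0).

Lemma mem_zero_ideal x : x \in zero_ideal <-> x = 0.
Proof.
apply: (mem_ideal_genE (P := fun x => x = 0)) => // [y z -> ->|a y ->].
  by rewrite subrr.
by rewrite mulr0.
Qed.

Lemma closed_fg (s : seq Rh) : closed (adjoin_seq zero_ideal s).
Proof.
elim: s => [|a s IHs]; last exact: closed_adjoin.
(* The [K_n] meet in zero, so the zero ideal is closed. *)
move=> x xnear; apply/mem_zero_ideal; apply: completion_ext => n.
by have [y /mem_zero_ideal ->] := xnear n.
Qed.

End Completion.

(** * Cyclic purity as contraction of extended ideals, and finite generation *)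

Lemma cyclically_pureP (A B : comPzRingType) (f : {rmorphism A -> B}) :
  cyclically_pure f <->
  injective f /\ forall (I : ideal A) x, f x \in ideal_ext f I -> x \in I.
Proof.
split=> -[finj fI]; split=> // I.
  move=> x fx; rewrite -[x]subr0; apply/idprojP; apply: (fI I).
  by rewrite !quot_map_extE; apply/idprojP; rewrite rmorph0 subr0.
move=> x y; rewrite -[x]idreprK -[y]idreprK !quot_map_extE => /idprojP.
by rewrite -rmorphB => /fI ?; apply/idprojP.
Qed.

(** An element of the extension is a finite sum, so it involves finitely many elements of [I]. *)
Lemma ideal_ext_fg (A B : comPzRingType) (g : {rmorphism A -> B})
    (I J : ideal A) y : y \in ideal_ext g I ->
  exists2 s : seq A, {subset s <= I} & y \in ideal_ext g (adjoin_seq J s).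
Proof.
case/asboolP=> u [+ ->]; elim: u => [|p u IHu] uI.
  by exists [::] => //; rewrite big_nil rpred0.
have [q qu|s sI us] := IHu; first by apply: uI; rewrite inE qu orbT.
have [a aI pa] := uI p (mem_head _ _).
exists (a :: s) => [b|]; first by rewrite inE => /predU1P[->|/sI].
rewrite big_cons rpredD //.
  by rewrite idealM //; apply: mem_ideal_gen; exists a; rewrite ?adjoin_mem.
move: us; apply: ideal_gen_min => _ [b bs ->].
by apply: mem_ideal_gen; exists b => //; apply: sub_adjoin.
Qed.

(** * Maps from the tensor product to quotients of [S] *)

Section BaseChange.
Variables (R S : comPzRingType) (f : {rmorphism R -> S}) (m : ideal R).
Local Notation Rh := (completion m).
Local Notation T := (tensor f (to_completion m)).

Lemma base_change_near (I : ideal Rh) (x : Rh) n :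
  cyclically_pure f ->
  (tens_inr f (to_completion m) x : T) \in
    ideal_ext (tens_inr f (to_completion m)) I ->
  near n I x.
Proof.
move=> /cyclically_pureP[_ fpure].
pose I0 := contract n I; pose E := ideal_ext f I0.
(* An arbitrary lift to [R], not additive in general. Since [I0] contains [m^n], the class of
   [f (rep y)] modulo [E] depends only on the image of [y] in [R / m^n]. *)
pose rep (y : Rh) := idrepr (comp_coord y n).
have fE r : r \in I0 -> f r \in E by move=> rI; apply: mem_ideal_gen; exists r.
have repE y r : comp_coord y n = idproj (ideal_pow m n) r ->
    idproj E (f (rep y)) = idproj E (f r).
  move=> yr; apply/idprojP; rewrite -rmorphB.
  by apply/fE/ideal_pow_contract/idprojP; rewrite -yr idreprK.
pose phi s y := idproj E (s * f (rep y)).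
have phiE s y : phi s y = idproj E s * idproj E (f (rep y)) by exact: rmorphM.
have [||s r y|h hE] := @tensor_rec _ _ _ f (to_completion m) _ phi.
- by move=> s t y; rewrite /phi mulrDl rmorphD.
- move=> s y z; rewrite !phiE -mulrDr -rmorphD -rmorphD; congr (_ * _).
  by apply: repE; rewrite rmorphD /= !idreprK.
- rewrite phiE [RHS]phiE [idproj E (s * _)]rmorphM -[LHS]mulrA; congr (_ * _).
  rewrite -[LHS]rmorphM -rmorphM.
  by apply/esym/repE; rewrite rmorphM /= idreprK.
have repI y : y \in I -> rep y \in I0.
  by move=> yI; apply/mem_contract; exists y => //; apply: congr_comp_repr.
(* As [h] is only known to be additive, a multiple of [1 (x) y] is first expanded into pure tensors
   [a (x) (b * y)], where [b * y] is in [I]. *)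
have hI t : t \in ideal_ext (tens_inr f (to_completion m)) I -> h t = 0.
  case/asboolP=> s [sP ->]; rewrite raddf_sum big_seq big1 // => -[u v] /sP /=.
  case=> y yI ->; rewrite -[u]tens_reprK tens_sum mulr_suml raddf_sum big1 //.
  move=> [a b] _; rewrite [_ * _]tensM hE; apply/idproj_eq0.
  by rewrite idealM // fE // repI // idealM.
move=> /hI; rewrite [_ x]/(tens _ _ 1 x) hE /phi mul1r.
move/idproj_eq0/fpure/mem_contract.
exact/near_congr/esym/congr_comp_repr.
Qed.

End BaseChange.

Theorem lemma4p2 (R S : comPzRingType) (f : {rmorphism R -> S})
  (m : ideal R) :
  noetherian R -> noetherian S -> local_with m ->
  cyclically_pure f ->
  cyclically_pure
    (tens_inr f (to_completion m)
       : {rmorphism completion m -> tensor f (to_completion m)}).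
Proof.
move=> noeR _ [mmax _] fpure.
have pure (I : ideal (completion m)) x :
    (tens_inr f (to_completion m) x : tensor f (to_completion m)) \in
      ideal_ext (tens_inr f (to_completion m)) I -> x \in I.
  case/(ideal_ext_fg (zero_ideal m))=> s sI xs.
  have : x \in adjoin_seq (zero_ideal m) s.
    by apply: closed_fg => // n; apply: base_change_near fpure xs.
  by apply: adjoin_seq_min => // _ /mem_zero_ideal ->; rewrite rpred0.
apply/cyclically_pureP; split=> // x y xy.
(* Injectivity is the contraction property at the zero ideal, applied to [x - y]. *)
apply/subr0_eq/mem_zero_ideal/pure.
by rewrite rmorphB /= xy subrr rpred0.
Qed.
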